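(* For every positive integer $n$, \[ q(n) = L+\sum_{k=1}^\infty (-1)^{k+1} \Big( q\Big( \frac{2n-P_{5,k}}{2}\Big) +q\Big( \frac{2n-Q_{5,k}}{2}\Big) \Big), \] where $P_{5,k}=\frac{k(3k-1)}{2}$, $Q_{5,k}=\frac{k(3k+1)}{2}$, and \[ L = \begin{cases} -1, &\text{if } 2n=\Delta_{4k+1}\text{ or } 2n=\Delta_{4k+2}\text{ for some }k\in\mathbb{N}_0, \\ 1, &\text{if } 2n=\Delta_{4k+3}\text{ or }2n=\Delta_{4k+4}\text{ for some }k\in\mathbb{N}_0, \\ 0, & \text{otherwise.} \end{cases} \]
   Context: $q(n)$ is the number of partitions of $n$ into distinct parts, with $q(0)=1$, and $q(x)=0$ for every rational $x\notin\mathbb{N}_0$ (in particular for non-integers and negative numbers). $\Delta_m=\frac{m(m+1)}{2}$ is the $m$-th triangular number. *)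

(* Defs.v *)
From mathcomp Require Import all_boot all_order all_algebra.
From Stdlib Require Import ClassicalEpsilon.
Set Implicit Arguments. Unset Strict Implicit. Unset Printing Implicit Defensive.
Import Order.TTheory GRing.Theory Num.Theory.
Local Open Scope ring_scope.

(* q n = number of partitions of n into distinct (positive) parts:
   the number of sets A of positive integers (necessarily all <= n)
   with sum n.  q 0 = 1 (the empty set). *)
Definition q (n : nat) : nat :=
  #|[set A : {set 'I_n.+1} | (ord0 \notin A) && ((\sum_(i in A) (i : nat))%N == n)]|.

Definition qQ (x : rat) : int :=
  if (x \is a Num.int) && (0 <= x) then (q `|numq x|%N)%:Z else 0.

Definition Delta (m : nat) : nat := (m * m.+1)./2.

Definition P5 (k : nat) : rat := k%:R * (3 * k%:R - 1) / 2.
Definition Q5 (k : nat) : rat := k%:R * (3 * k%:R + 1) / 2.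

Definition L (n : nat) : int :=
  if excluded_middle_informative
       (exists k : nat, (2 * n = Delta (4 * k + 1))%N \/ (2 * n = Delta (4 * k + 2))%N)
  then -1
  else if excluded_middle_informative
       (exists k : nat, (2 * n = Delta (4 * k + 3))%N \/ (2 * n = Delta (4 * k + 4))%N)
  then 1
  else 0.

(* Main.v *)
(* With Q(x) = prod (1 + x^j) the generating function of q, the identity is the
   coefficient of x^(2n) in
     Q(x^2) * prod (1 - x^j) = prod (1 - x^(4j)) (1 - x^(4j-1)) (1 - x^(4j-3)).
   Both products not involving Q are cases of Jacobi's triple product
     prod (1 - x^(aj)) (1 - x^(aj-b)) (1 - x^(aj-a+b))
       = sum_(m in Z) (-1)^m x^(a m(m-1)/2 + bm):
   a = 3 gives the pentagonal number theorem, a = 4 gives a signed series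
   supported on the triangular numbers.  Modulo x^d, the triple product follows
   from the q-binomial theorem, since qbin(2N, N+m) * (q)_N tends to 1. *)
Require Import Defs.
From mathcomp Require Import all_boot all_order all_algebra.
From mathcomp Require Import zify ring.
Import Order.TTheory GRing.Theory Num.Theory.
Local Open Scope ring_scope.
Set Implicit Arguments. Unset Strict Implicit. Unset Printing Implicit Defensive.

(** * Congruence of integer polynomials modulo ['X^d] *)

Definition eqXn (d : nat) (p r : {poly int}) : Prop :=
  forall i, (i < d)%N -> p`_i = r`_i.

Lemma eqXn_refl d p : eqXn d p p. Proof. by []. Qed.

Lemma eqXn_sym d p r : eqXn d p r -> eqXn d r p.
Proof. by move=> h i /h. Qed.

Lemma eqXn_trans d r p s : eqXn d p r -> eqXn d r s -> eqXn d p s.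
Proof. by move=> h1 h2 i id; rewrite h1 ?h2. Qed.

Lemma eqXnD d p p' r r' : eqXn d p p' -> eqXn d r r' -> eqXn d (p + r) (p' + r').
Proof. by move=> h1 h2 i id; rewrite !coefD h1 ?h2. Qed.

Lemma eqXnM d p p' r r' : eqXn d p p' -> eqXn d r r' -> eqXn d (p * r) (p' * r').
Proof.
move=> h1 h2 i id; rewrite !coefM; apply: eq_bigr => j _.
by rewrite h1 ?h2 //; have := ltn_ord j; lia.
Qed.

Lemma eqXn_sum d (I : Type) (s : seq I) (P : pred I) (F G : I -> {poly int}) :
  (forall i, P i -> eqXn d (F i) (G i)) ->
  eqXn d (\sum_(i <- s | P i) F i) (\sum_(i <- s | P i) G i).
Proof.
by move=> h; apply: (big_ind2 (eqXn d)) => //; move=> *; apply: eqXnD.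
Qed.

(** Constant term 1 makes [A] invertible as a power series; the coefficients are compared by strong
    induction. *)
Lemma eqXn_cancel d (A p r : {poly int}) : A`_0 = 1 -> eqXn d (A * p) (A * r) -> eqXn d p r.
Proof.
move=> A0 h i; elim/ltn_ind: i => i IH id.
have := h i id; rewrite !coefM !big_ord_recl A0 subn0 !mul1r.
rewrite (eq_bigr (fun j : 'I_i => A`_(lift ord0 j) * r`_(i - lift ord0 j))).
  by move/addIr.
by move=> j _; rewrite !lift0 IH //; have := ltn_ord j; lia.
Qed.

Lemma eqXn_Xn_mul d e p : (d <= e)%N -> eqXn d ('X^e * p) 0.
Proof. by move=> de i id; rewrite coefXnM coef0; case: ltnP => //; lia. Qed.

Lemma eqXn_1BXn d e : (d <= e)%N -> eqXn d (1 - 'X^e) 1.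
Proof.
move=> de i id; rewrite coefB coefXn; case: eqP => [ie|_]; last by rewrite subr0.
by exfalso; lia.
Qed.

Lemma eqXn_prod_widen d (F : nat -> {poly int}) m n :
  (m <= n)%N -> (forall i, (m <= i)%N -> eqXn d (F i) 1) ->
  eqXn d (\prod_(i < n) F i) (\prod_(i < m) F i).
Proof.
move=> mn hF; rewrite -(subnKC mn); elim: (n - m)%N => [|k IH].
  by rewrite addn0.
rewrite addnS big_ord_recr /= -[X in eqXn _ _ X]mulr1.
by apply: eqXnM => //; apply: hF; exact: leq_addr.
Qed.

(** * Gaussian binomials and the q-binomial theorem *)

Section QBinomial.
Variables (R : comNzRingType) (q : R).

Fixpoint qbin (n k : nat) : R :=
  match n, k with
  | _, 0 => 1
  | 0, _.+1 => 0
  | n'.+1, k'.+1 => q ^+ k * qbin n' k + qbin n' k'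
  end.

Definition qfact (n : nat) : R := \prod_(i < n) (1 - q ^+ i.+1).

Lemma qfactS n : qfact n.+1 = qfact n * (1 - q ^+ n.+1).
Proof. by rewrite /qfact big_ord_recr. Qed.

Lemma qbin0 n : qbin n 0 = 1. Proof. by case: n. Qed.

Lemma qbin_small n k : (n < k)%N -> qbin n k = 0.
Proof.
elim: n k => [|n IH] [|k] //= nk.
by rewrite !IH ?mulr0 ?addr0 //; lia.
Qed.

(** Induction by the q-Pascal rule, since [1 - q ^+ n.+1] splits as [q ^+ k.+1 * (1 - q ^+ (n - k))
    + (1 - q ^+ k.+1)]. *)
Lemma qbin_fact n k : (k <= n)%N -> qbin n k * (qfact k * qfact (n - k)) = qfact n.
Proof.
elim: n k => [|n IH] [|k] //= kn.
- by rewrite /qfact !big_ord0 !mul1r.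
- by rewrite subn0 mul1r {1}/qfact big_ord0 mul1r.
rewrite subSS.
move: kn; rewrite ltnS leq_eqVlt => /orP[/eqP->|kn].
  rewrite (qbin_small (ltnSn n)) mulr0 add0r qfactS -[in RHS](IH n) // subnn.
  by ring.
have e : (n - k = (n - k.+1).+1)%N by lia.
have h1 := IH k.+1 kn; have h2 := IH k (ltnW kn).
rewrite mulrDl.
have -> : q ^+ k.+1 * qbin n k.+1 * (qfact k.+1 * qfact (n - k)) =
  q ^+ k.+1 * (1 - q ^+ (n - k)) * qfact n.
  by rewrite -h1 e (qfactS (n - k.+1)); ring.
have -> : qbin n k * (qfact k.+1 * qfact (n - k)) = (1 - q ^+ k.+1) * qfact n.
  by rewrite -h2 qfactS; ring.
rewrite qfactS.
have -> : q ^+ n.+1 = q ^+ k.+1 * q ^+ (n - k) by rewrite -exprD; congr (_ ^+ _); lia.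
by ring.
Qed.

(** Peel off the factor [i = 0] and use induction at [z * q]; multiplying by [w + z] reproduces the
    q-Pascal rule. *)
Lemma qbinomial_theorem (w z : R) n :
  \prod_(i < n) (w + z * q ^+ i) =
  \sum_(k < n.+1) q ^+ 'C(k, 2) * z ^+ k * w ^+ (n - k) * qbin n k.
Proof.
elim: n z => [|n IH] z.
  by rewrite big_ord0 big_ord1 /= !expr0 !mulr1.
rewrite big_ord_recl expr0 mulr1.
under eq_bigr => i _ do rewrite lift0 exprS mulrA.
rewrite IH mulrDl [in RHS]big_ord_recl /=.
under [X in _ = _ + X]eq_bigr => i _ do
  rewrite /bump add1n subSS mulrDr binS bin1 !exprD.
rewrite big_split /= addrA; congr (_ + _); last first.
  by rewrite mulr_sumr; apply: eq_bigr => i _; rewrite exprMn exprS; ring.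
rewrite mulr_sumr big_ord_recl [in RHS]big_ord_recr /= (qbin_small (ltnSn n)).
rewrite !mulr0 addr0 !qbin0 !subn0 !expr0; congr (_ + _).
  by rewrite exprS; ring.
apply: eq_bigr => i _; rewrite /bump add1n binS bin1 !exprD exprMn.
have -> : (n - i = (n - i.+1).+1)%N by have := ltn_ord i; lia.
by rewrite [w ^+ _.+1]exprS; ring.
Qed.

End QBinomial.

(** * Finite form of the triple product *)

Lemma bin2D m n : 'C(m + n, 2) = ('C(m, 2) + 'C(n, 2) + m * n)%N.
Proof.
elim: m => [|m IH]; first by rewrite !add0n mul0n addn0.
by rewrite addSn !binS !bin1 IH; lia.
Qed.

Lemma bin2_sqr m : ('C(m, 2) + 'C(m, 2) + m = m * m)%N.
Proof. by elim: m => [|m IH] //; rewrite binS bin1; lia. Qed.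

(** Recentring at [N] pairs the terms [m] and [-m] of a bilateral sum. *)
Lemma sum_around (V : zmodType) (F : nat -> V) N :
  \sum_(k < (2 * N).+1) F k =
  F N + \sum_(1 <= m < N.+1) (F (N + m)%N + F (N - m)%N).
Proof.
rewrite -(big_mkord xpredT F) (big_cat_nat (n := N)) //=; last by lia.
rewrite [X in _ + X]big_ltn; last by lia.
rewrite addrCA; congr (_ + _); rewrite big_split /= addrC; congr (_ + _).
  rewrite -{1}[N.+1]addn1 addnC big_addn; have -> : ((2 * N).+1 - N = N.+1)%N by lia.
  by apply: eq_bigr => i _; rewrite addnC.
rewrite big_nat_rev /= big_add1 /= !big_mkord; apply: eq_bigr => i _.
by congr F; lia.
Qed.

(* The terms m and -m of the bilateral sum have exponents [jexp a b m] and
   [jexp a (a - b) m]. *)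
Definition jexp (a b m : nat) : nat := a * 'C(m, 2) + b * m.

Lemma leq_jexp a b m : (0 < b)%N -> (m <= jexp a b m)%N.
Proof. by rewrite /jexp; nia. Qed.

Lemma triple_product_finite (b c N : nat) :
  \prod_(i < N) ((1 - 'X^((b + c) * i + b)) * (1 - 'X^((b + c) * i + c))) =
  qbin ('X^(b + c)) (2 * N) N +
  \sum_(1 <= m < N.+1) (-1) ^+ m *
    ('X^(jexp (b + c) b m) * qbin ('X^(b + c)) (2 * N) (N + m) +
     'X^(jexp (b + c) c m) * qbin ('X^(b + c)) (2 * N) (N - m)) :> {poly int}.
Proof.
set a := (b + c)%N; set s := (b * N + a * 'C(N, 2) + a * N * N)%N.
have s0 : (-1) ^+ N * 'X^s != 0 :> {poly int}.
  by rewrite mulf_neq0 ?signr_eq0 // monic_neq0 ?monicXn.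
(* The q-binomial theorem is used at z = - 'X^b and w = q ^+ N, which makes the
   product symmetric up to the factor (-1)^N 'X^s without negative powers. *)
apply: (mulfI s0).
have prodX (f : nat -> nat) : \prod_(i < N) 'X^(f i) = 'X^(\sum_(i < N) f i) :> {poly int}.
  by elim/big_ind2: _ => [|p x r y -> ->|] //; rewrite exprD.
have <- : \prod_(i < 2 * N) ('X^(a * N) + (- 'X^b) * ('X^a) ^+ i) =
  (-1) ^+ N * 'X^s *
  \prod_(i < N) ((1 - 'X^(a * i + b)) * (1 - 'X^(a * i + c))) :> {poly int}.
  rewrite mul2n -addnn big_split_ord /= big_split /=.
  (* The lower half, reversed, yields the factors with [c], as
     [a * N - (b + a * (N - i.+1)) = a * i + c]; the upper half yields those with [b]. *)
  rewrite (reindex_inj rev_ord_inj) /=.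
  rewrite [X in X * _](eq_bigr (fun i : 'I_N =>
    (-1) * 'X^(b + a * (N - i.+1)) * (1 - 'X^(a * i + c)))); last first.
    move=> i _; rewrite mulN1r !mulNr mulrBr mulr1 opprB -exprM -!exprD.
    by congr ('X^_ - 'X^_); have := ltn_ord i; rewrite /a; nia.
  rewrite [X in _ * X](eq_bigr (fun i : 'I_N => 'X^(a * N) * (1 - 'X^(a * i + b)))); last first.
    move=> i _; rewrite mulrBr mulr1 mulNr -exprM -!exprD.
    by congr ('X^_ - 'X^_); nia.
  rewrite !big_split /= (prodX (fun i => b + a * (N - i.+1))%N).
  rewrite !prodr_const card_ord -exprM.
  have -> : (\sum_(i < N) (b + a * (N - i.+1)) = b * N + a * 'C(N, 2))%N.
    rewrite big_split /= sum_nat_const card_ord mulnC -big_distrr /=; congr (_ + a * _)%N.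
    rewrite (reindex_inj rev_ord_inj) /= -bin2_sum big_mkord.
    by apply: eq_bigr => i _; have := ltn_ord i; lia.
  rewrite /s !exprD; ring.
rewrite qbinomial_theorem.
rewrite (sum_around (fun k => ('X^a) ^+ 'C(k, 2) * (- 'X^b) ^+ k * ('X^(a * N)) ^+ (2 * N - k)
   * qbin 'X^a (2 * N) k)).
(* [s] is the exponent of the central term [k = N]; [e] is what term [k] has beyond it, and [t]
   gives its relative sign. *)
have key k e t : (a * 'C(k, 2) + b * k + a * N * (2 * N - k) = s + e)%N ->
  odd k = odd (N + t) ->
  ('X^a) ^+ 'C(k, 2) * (- 'X^b) ^+ k * ('X^(a * N)) ^+ (2 * N - k) =
  (-1) ^+ N * 'X^s * ((-1) ^+ t * 'X^e) :> {poly int}.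
  move=> he ho; rewrite (exprNn 'X^b) -!exprM.
  have -> : (-1) ^+ k = (-1) ^+ N * (-1) ^+ t :> {poly int}.
    by rewrite -exprD -signr_odd ho signr_odd.
  have -> : (-1) ^+ N * 'X^s * ((-1) ^+ t * 'X^e) =
      (-1) ^+ N * (-1) ^+ t * 'X^(s + e) :> {poly int}.
    by rewrite exprD; ring.
  by rewrite -he !exprD; ring.
rewrite mulrDr; congr (_ + _).
  rewrite (key _ 0%N 0%N) ?addn0 ?expr0 ?mulr1 //.
  by rewrite /s; nia.
rewrite mulr_sumr; apply: eq_big_nat => m /andP[m1 mN].
rewrite (key (N + m)%N (jexp a b m) m) //; last first.
  rewrite /s /jexp bin2D; have -> : (2 * N - (N + m) = N - m)%N by lia.
  have [p ->] : exists p, N = (m + p)%N by exists (N - m)%N; lia.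
  by rewrite addKn; nia.
rewrite (key (N - m)%N (jexp a c m) m); first by ring.
  have [p hp] : exists p, N = (m + p)%N by exists (N - m)%N; lia.
  have e2 := bin2_sqr m.
  rewrite /s /jexp hp addKn bin2D; have -> : (2 * (m + p) - p = m + m + p)%N by lia.
  rewrite /a; nia.
by rewrite oddD oddB; [|lia].
Qed.

(** * The triple product modulo ['X^d] *)

Lemma qfact_Xn_stable a d m : (0 < a)%N -> (d <= m)%N ->
  eqXn d (qfact ('X^a) m) (qfact ('X^a) d).
Proof.
move=> a0 dm; apply: (eqXn_prod_widen (F := fun i => 1 - ('X^a) ^+ i.+1)) => // i di.
by rewrite -exprM; apply: eqXn_1BXn; nia.
Qed.

Lemma qfact_Xn_coef0 a m : (0 < a)%N -> (qfact ('X^a) m : {poly int})`_0 = 1.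
Proof.
move=> a0; elim: m => [|m IH]; first by rewrite /qfact big_ord0 coef1.
rewrite qfactS coef0M IH mul1r -exprM coefB coefXn coef1 /=.
by case: eqP => [|_]; [nia | rewrite subr0].
Qed.

(** The three q-factorials in [qbin_fact] are all congruent to [qfact 'X^a d], and one copy
    cancels. *)
Lemma qfact_qbin_Xn a d n k : (0 < a)%N -> (k <= n)%N -> (d <= k)%N -> (d <= n - k)%N ->
  eqXn d (qfact ('X^a) d * qbin ('X^a) n k) 1.
Proof.
move=> a0 kn dk dnk; apply: (@eqXn_cancel d (qfact 'X^a d)).
  exact: qfact_Xn_coef0.
rewrite mulr1.
have h := qfact_Xn_stable a0.
apply: (@eqXn_trans _ (qfact 'X^a n)); last by apply: h; lia.
rewrite -(qbin_fact _ kn).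
have -> : qfact 'X^a d * (qfact 'X^a d * qbin 'X^a n k) =
  qbin 'X^a n k * (qfact 'X^a d * qfact 'X^a d) :> {poly int} by ring.
apply: eqXnM => //.
by apply: eqXnM; apply: eqXn_sym; apply: h.
Qed.

Definition theta (b c d : nat) : {poly int} :=
  1 + \sum_(1 <= m < d) (-1) ^+ m * ('X^(jexp (b + c) b m) + 'X^(jexp (b + c) c m)).

Lemma triple_product (b c d N : nat) : (0 < b)%N -> (0 < c)%N -> (2 * d <= N)%N ->
  eqXn d
    (\prod_(i < N) ((1 - 'X^((b + c) * i + b)) * (1 - 'X^((b + c) * i + c))
                    * (1 - 'X^((b + c) * i.+1))))
    (theta b c d).
Proof.
move=> b0 c0 dN; rewrite /theta big_split /= triple_product_finite mulrC.
have a0 : (0 < b + c)%N by lia.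
move: (b + c)%N a0 => a a0.
(* As [2 * d <= N], the indices [N + m] and [N - m] with [m < d] stay at distance at least [d] from
   [0] and [2 * N]. *)
have hq k : (d <= k)%N -> (d <= 2 * N - k)%N -> (k <= 2 * N)%N ->
    eqXn d (\prod_(i < N) (1 - 'X^(a * i.+1)) * qbin 'X^a (2 * N) k) 1.
  move=> h1 h2 h3; apply: eqXn_trans (qfact_qbin_Xn a0 h3 h1 h2).
  apply: eqXnM => //; under eq_bigr => i _ do rewrite exprM.
  by apply: qfact_Xn_stable => //; lia.
rewrite mulrDr; apply: eqXnD; first by apply: hq; lia.
rewrite mulr_sumr; case: d dN hq => [|d] dN hq; first by [].
(* Terms from [m = d.+1] on vanish modulo ['X^(d.+1)], because their exponents are at least [m]. *)
rewrite (big_cat_nat (n := d.+1)) //=; last by lia.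
rewrite -[X in eqXn _ _ X]addr0; apply: eqXnD.
  rewrite !big_nat; apply: eqXn_sum => m /andP[m1 md].
  rewrite [X in eqXn _ X _]mulrCA; apply: eqXnM => //; rewrite mulrDr.
  by apply: eqXnD; rewrite [X in eqXn _ X _]mulrCA -[X in eqXn _ _ X]mulr1;
    apply: eqXnM => //; apply: hq; lia.
rewrite [X in eqXn _ _ X](_ : 0 = \sum_(d.+1 <= m < N.+1) 0); last by rewrite big1.
rewrite !big_nat; apply: eqXn_sum => m /andP[m1 md].
rewrite mulrDr mulrDr -[X in eqXn _ _ X]addr0.
by apply: eqXnD; rewrite mulrA mulrCA; apply: eqXn_Xn_mul;
  apply: (leq_trans m1); exact: leq_jexp.
Qed.

(** * Rearranging the products *)

Lemma prod_split3 N : \prod_(i < N)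
    ((1 - 'X^((1 + 2) * i + 1)) * (1 - 'X^((1 + 2) * i + 2)) * (1 - 'X^((1 + 2) * i.+1))) =
  \prod_(i < 3 * N) (1 - 'X^(i.+1)) :> {poly int}.
Proof.
elim: N => [|N IH]; first by rewrite muln0 !big_ord0.
have e : (3 * N.+1 = (3 * N).+3)%N by lia.
rewrite big_ord_recr IH {IH} e !big_ord_recr /= -!mulrA.
by congr (_ * ((1 - 'X^_) * ((1 - 'X^_) * (1 - 'X^_)))); lia.
Qed.

Lemma prod_split_odd N : \prod_(i < N) ((1 - 'X^((1 + 3) * i + 1)) * (1 - 'X^((1 + 3) * i + 3))) =
  \prod_(i < 2 * N) (1 - 'X^((2 * i).+1)) :> {poly int}.
Proof.
elim: N => [|N IH]; first by rewrite muln0 !big_ord0.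
have e : (2 * N.+1 = (2 * N).+2)%N by lia.
rewrite big_ord_recr IH {IH} e !big_ord_recr /= -!mulrA.
by congr (_ * ((1 - 'X^_) * (1 - 'X^_))); lia.
Qed.

(** Each step absorbs an even factor by [(1 + x^(2j)) (1 - x^(2j)) = 1 - x^(4j)]; the odd factors
    remain. *)
Lemma prod_distinct_euler K :
  \prod_(i < K) (1 + 'X^(2 * i.+1)) * \prod_(i < 2 * K) (1 - 'X^(i.+1)) =
  \prod_(i < K) (1 - 'X^((2 * i).+1)) * \prod_(i < K) (1 - 'X^(4 * i.+1)) :> {poly int}.
Proof.
elim: K => [|K IH]; first by rewrite muln0 !big_ord0.
have e : (2 * K.+1 = (2 * K).+2)%N by lia.
rewrite [in X in _ * X]e !big_ord_recr /= -e [RHS]mulrACA -IH.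
have -> : (4 * K.+1 = 2 * K.+1 + 2 * K.+1)%N by lia.
by rewrite exprD; ring.
Qed.

Lemma theta_pentagonal d K : (4 * d <= K)%N ->
  eqXn d (\prod_(i < K) (1 + 'X^(2 * i.+1)) * theta 1 2 d) (theta 1 3 d).
Proof.
(* [N] is the least length that [triple_product] allows; the products then have [3 * N] and [2 * N]
   factors, and [4 * d <= K] lets them be extended to [2 * K] and [K]. *)
move=> dK; set N := (2 * d)%N.
have w (F : nat -> {poly int}) (m n : nat) : (d <= m)%N -> (m <= n)%N ->
    (forall i, (m <= i)%N -> exists2 e, (d <= e)%N & F i = 1 - 'X^e) ->
    eqXn d (\prod_(i < n) F i) (\prod_(i < m) F i).
  move=> _ mn h; apply: eqXn_prod_widen => // i /h[e de ->]; exact: eqXn_1BXn.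
have h3 := @triple_product 1 2 d N isT isT (leqnn _).
have h4 := @triple_product 1 3 d N isT isT (leqnn _).
apply: eqXn_trans (eqXn_trans _ h4).
  apply: eqXnM; [exact: eqXn_refl | exact: eqXn_sym h3].
rewrite prod_split3 big_split /= prod_split_odd.
apply: (@eqXn_trans _ (\prod_(i < K) (1 + 'X^(2 * i.+1)) * \prod_(i < 2 * K) (1 - 'X^(i.+1)))).
  apply: eqXnM => //; apply: eqXn_sym.
    apply: (w (fun i => 1 - 'X^(i.+1))); rewrite /N; try lia.
  by move=> i hi; exists i.+1 => //; lia.
rewrite prod_distinct_euler; apply: eqXnM.
  apply: (w (fun i => 1 - 'X^((2 * i).+1))); rewrite /N; try lia.
  by move=> i hi; exists (2 * i).+1 => //; lia.
apply: (w (fun i => 1 - 'X^(4 * i.+1))); rewrite /N; try lia.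
by move=> i hi; exists (4 * i.+1)%N => //; lia.
Qed.

(** * Values of [q] and [qQ] as coefficients *)

Lemma coef_prod_distinct K n : (n <= K)%N ->
  (\prod_(i < K) (1 + 'X^(i.+1)) : {poly int})`_n = (q n)%:Z.
Proof.
move=> nK.
have -> : (\prod_(i < K) (1 + 'X^(i.+1)) : {poly int})`_n =
          (\prod_(i < n) (1 + 'X^(i.+1)) : {poly int})`_n.
  apply: (@eqXn_prod_widen n.+1 (fun i => 1 + 'X^(i.+1))) => // i ni j jn.
  by rewrite coefD coefXn; case: eqP => [ji|_]; [exfalso; lia | rewrite addr0].
(* A factor 1 for index 0 is added to match the index type in [q]; written as [0 * 'X^0 + 1], it
   gives weight 0 to the sets containing [ord0]. *)
have -> : \prod_(i < n) (1 + 'X^(i.+1)) =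
    \prod_(i < n.+1) ((i != ord0)%:R * 'X^i + 1) :> {poly int}.
  rewrite big_ord_recl eqxx mul0r add0r mul1r; apply: eq_bigr => i _.
  by rewrite lift0 mul1r addrC.
rewrite bigA_distr coef_sum /q -natz -sum1_card natr_sum big_mkcond /=.
rewrite [RHS](big_mkcond (fun A => A \in _)) /=.
apply: eq_bigr => A _; rewrite inE.
have -> : \prod_(i < n.+1) (if i \in A then (i != ord0)%:R * 'X^i else 1) =
   (ord0 \notin A)%:R * 'X^(\sum_(i in A) (i : nat)) :> {poly int}.
  rewrite -big_mkcond /= big_split /=; congr (_ * _).
    case: (boolP (ord0 \in A)) => [h|h]; first by rewrite (bigD1 ord0) //= mul0r.
    rewrite big1 // => i iA; case: eqP => // i0; by rewrite i0 (negbTE h) in iA.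
  by elim/big_ind2: _ => [|p x r y -> ->|] //; rewrite exprD.
case: (ord0 \notin A) => /=; last by rewrite mul0r coef0.
by rewrite mul1r coefXn eq_sym; case: eqP.
Qed.

Lemma coef_prod_distinct_even K n : (n <= 2 * K)%N ->
  (\prod_(i < K) (1 + 'X^(2 * i.+1)) : {poly int})`_n =
  if odd n then 0 else (q n./2)%:Z.
Proof.
move=> nK.
have -> : \prod_(i < K) (1 + 'X^(2 * i.+1)) =
    (\prod_(i < K) (1 + 'X^(i.+1))) \Po 'X^2 :> {poly int}.
  elim/big_rec2: _ => [|i p r _ ->]; first by rewrite comp_polyC.
  rewrite comp_polyM comp_polyD comp_polyC; congr ((_ + _) * _).
  by rewrite comp_Xn_poly -exprM.
rewrite coef_comp_poly_Xn // dvdn2 divn2; case: (odd n) => //=.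
by rewrite coef_prod_distinct //; lia.
Qed.

Lemma qQ_half (x : int) : qQ (x%:~R / 2) =
  if (0 <= x) && ~~ odd `|x|%N then (q `|x|%N./2)%:Z else 0.
Proof.
rewrite /qQ.
case: (lerP 0 x) => [x0|x0]; last first.
  rewrite [X in _ && X](_ : _ = false) ?andbF //.
  by apply/negbTE; rewrite -ltNge pmulr_llt0 ?ltrz0.
case: x x0 => // m _ /=.
have -> : (0 <= m%:~R / 2 :> rat) by rewrite divr_ge0 ?ler0z.
rewrite andbT.
case: (boolP (odd m)) => om.
  rewrite ifF //=; apply/negbTE/negP => /intrP[z hz].
  have : (m%:~R = (z * 2)%:~R :> rat) by rewrite intrM -hz divfK.
  by move/intr_inj => h; lia.
have -> : (m%:~R / 2 = (m./2)%:~R :> rat).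
  rewrite -[in LHS](even_halfK om) -muln2 PoszM intrM mulfK //.
by rewrite intr_int numq_int.
Qed.

(** Where [2 * n - p] is negative or odd the coefficient vanishes, in agreement with the default 0
    of [qQ]. *)
Lemma coef_distinct_shift K n (p : nat) : (n <= K)%N ->
  (\prod_(i < K) (1 + 'X^(2 * i.+1)) * 'X^p : {poly int})`_(2 * n) =
  qQ ((2 * n%:R - p%:R) / 2).
Proof.
move=> nK; rewrite coefMXn.
have -> : (2 * n%:R - p%:R : rat) = ((2 * n)%:Z - p%:Z)%:~R.
  by rewrite intrB -!pmulrn natrM.
rewrite qQ_half.
case: ltnP => hp; first by rewrite ifF //; apply/negbTE; lia.
rewrite coef_prod_distinct_even; last by lia.
have -> : `|(2 * n)%:Z - p%:Z|%N = (2 * n - p)%N by lia.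
have -> /= : 0 <= (2 * n)%:Z - p%:Z by lia.
by case: odd.
Qed.

(** * Pentagonal and triangular numbers as theta exponents *)

Lemma P5_jexp k : P5 k = (jexp 3 1 k)%:R.
Proof.
rewrite /P5; apply: (mulIf (x := 2)) => //; rewrite divfK //.
elim: k => [|k IH]; first by rewrite /jexp !mul0r.
have -> : (jexp 3 1 k.+1)%:R = (jexp 3 1 k)%:R + 3 * k%:R + 1 :> rat.
  by rewrite -natrM -natrD natr1 /jexp binS bin1; congr (_%:R); lia.
by rewrite -addrA [RHS]mulrDl -IH -natr1; ring.
Qed.

Lemma Q5_jexp k : Q5 k = (jexp 3 2 k)%:R.
Proof.
have := P5_jexp k; rewrite /P5 /Q5.
have -> : (jexp 3 2 k = jexp 3 1 k + k)%N by rewrite /jexp; lia.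
by rewrite natrD => <-; field.
Qed.

Lemma Delta_bin m : Delta m = 'C(m.+1, 2).
Proof. by rewrite bin2 mulnC. Qed.

Lemma leq_Delta : {mono Delta : m n / (m <= n)%N}.
Proof.
apply: leq_mono; apply: homo_ltn => [|m]; first exact: ltn_trans.
by rewrite !Delta_bin [in X in (_ < X)%N]binS bin1; lia.
Qed.

(** Thus the bilateral series behind [theta 1 3] meets each [Delta j] with [j > 0] exactly once. *)
Lemma jexp4_Delta m : jexp 4 1 m.+1 = Delta (2 * m).+1 /\ jexp 4 3 m.+1 = Delta (2 * m).+2.
Proof.
have := bin2_sqr m.
by rewrite !Delta_bin /jexp !binS !bin1 !bin0 mul2n -addnn bin2D; nia.
Qed.

Lemma coef_sign_mul m (p : {poly int}) i : ((-1) ^+ m * p)`_i = (-1) ^+ m * p`_i.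
Proof.
by rewrite -signr_odd -[in RHS]signr_odd; case: odd; rewrite ?mul1r // !mulN1r coefN.
Qed.

Lemma coef_theta b c d n : (0 < n)%N ->
  (theta b c d)`_n = \sum_(1 <= m < d)
    (-1) ^+ m * ((n == jexp (b + c) b m)%:R + (n == jexp (b + c) c m)%:R).
Proof.
move=> n0; rewrite coefD coef1 gtn_eqF // add0r coef_sum.
by apply: eq_bigr => m _; rewrite coef_sign_mul coefD !coefXn.
Qed.

(** [Delta] is injective, so only the term [m = uphalf j] contributes. *)
Lemma coef_theta_Delta d j : (0 < j)%N -> (Delta j < d)%N ->
  (theta 1 3 d)`_(Delta j) = (-1) ^+ uphalf j.
Proof.
move=> j0 jd; have inj := incn_inj leq_Delta.
have jDj : (j <= Delta j)%N.
  by case: j {j0 jd} => // j; rewrite Delta_bin binS bin1; lia.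
rewrite coef_theta; last by lia.
rewrite (bigD1_seq (uphalf j)) ?iota_uniq ?mem_index_iota //=; last by lia.
rewrite big_nat_cond big1 ?addr0 => [|m /andP[/andP[m0 _] mj]].
  have [->|->] : j = (2 * (uphalf j).-1).+1 \/ j = (2 * (uphalf j).-1).+2 by lia.
    have -> : uphalf (2 * (uphalf j).-1).+1 = (uphalf j).-1.+1 by lia.
    have [-> ->] := jexp4_Delta (uphalf j).-1.
    by rewrite !(inj_eq inj) eqxx ltn_eqF // addr0 mulr1.
  have -> : uphalf (2 * (uphalf j).-1).+2 = (uphalf j).-1.+1 by lia.
  have [-> ->] := jexp4_Delta (uphalf j).-1.
  by rewrite !(inj_eq inj) eqxx gtn_eqF // add0r mulr1.
case: m m0 mj => // m _ mj; have [-> ->] := jexp4_Delta m; rewrite !(inj_eq inj).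
have [-> ->] : j == (2 * m).+1 = false /\ j == (2 * m).+2 = false by lia.
by rewrite addr0 mulr0.
Qed.

(** [uphalf j] is odd for [j] congruent to 1 or 2 modulo 4 and even otherwise, which gives the signs
    in [L]. *)
Lemma coef_theta_L n d : (0 < n)%N -> (2 * n < d)%N -> (theta 1 3 d)`_(2 * n) = L n.
Proof.
move=> n0 nd.
have sign j : (0 < j)%N -> (2 * n)%N = Delta j ->
    (theta 1 3 d)`_(2 * n) = (-1) ^+ odd (uphalf j).
  by move=> j0 e; rewrite signr_odd e coef_theta_Delta // -e.
rewrite /L; case: ClassicalEpsilon.excluded_middle_informative => [[k hk]|h1].
  case: hk => hk; rewrite (sign _ _ hk); try lia.
    by have -> : odd (uphalf (4 * k + 1)) = true by lia.
  by have -> : odd (uphalf (4 * k + 2)) = true by lia.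
case: ClassicalEpsilon.excluded_middle_informative => [[k hk]|h2].
  case: hk => hk; rewrite (sign _ _ hk); try lia.
    by have -> : odd (uphalf (4 * k + 3)) = false by lia.
  by have -> : odd (uphalf (4 * k + 4)) = false by lia.
(* Neither case of [L] holds, and the four residues exhaust all [j > 0]. *)
have nD j : (0 < j)%N -> (2 * n == Delta j)%N = false.
  move=> j0; apply/negbTE/eqP => e.
  have [k hk] : exists k, j = (4 * k + 1)%N \/
      j = (4 * k + 2)%N \/ j = (4 * k + 3)%N \/ j = (4 * k + 4)%N.
    by exists (j.-1 %/ 4)%N; lia.
  case: hk => [|[|[|]]] hk; rewrite hk in e; [apply: h1|apply: h1|apply: h2|apply: h2];
    exists k; by [left|right].
rewrite coef_theta; last by lia.
rewrite big_nat big1 // => -[|m] // _; have [-> ->] := jexp4_Delta m.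
by rewrite !nD // addr0 mulr0.
Qed.

(* The infinite series has only finitely many nonzero terms (for k > 2n the
   arguments of q are negative); its value is the partial sum up to any
   M >= 2n, which is how the series is rendered here. *)
Theorem theorem2p5 (n M : nat) : (0 < n)%N -> (2 * n <= M)%N ->
  (q n)%:Z = L n + \sum_(1 <= k < M.+1)
      (-1) ^+ k.+1 * (qQ ((2 * n%:R - P5 k) / 2) + qQ ((2 * n%:R - Q5 k) / 2)).
Proof.
move=> n0 nM.
have nK : (n <= 4 * M.+1)%N by lia.
(* Modulus [M.+1] covers degree [2 * n] and makes [theta 1 2] stop at [m = M], like the sum. *)
have := @theta_pentagonal M.+1 _ (leqnn _) (2 * n)%N nM.
rewrite coef_theta_L // => <-.
(* The term 1 of [theta 1 2] gives [q n]; the other terms cancel the sum one by one, their signs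
   being opposite. *)
rewrite mulrDr mulr1 coefD coef_prod_distinct_even; last by lia.
rewrite mul2n odd_double doubleK -mul2n -addrA mulr_sumr coef_sum -big_split /=.
rewrite big1 ?addr0 // => k _.
rewrite mulrCA coef_sign_mul mulrDr coefD !coef_distinct_shift // -P5_jexp -Q5_jexp.
by rewrite exprS mulN1r mulNr addrN.
Qed.
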